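(* There exist trees $T$ with arbitrarily large number of vertices $n$ satisfying $I_s(T) \leq \frac{5n+26}{12}$.
   Context: The competition-independence game on a graph $G$ is played by two players, Sweller and Diminisher, who alternately choose a vertex of $G$ not adjacent to (and distinct from) any previously chosen vertex, until no such vertex exists; the chosen set is then a maximal independent set of $G$. Sweller wants the final set to be as large as possible, Diminisher as small as possible. $I_s(G)$ denotes the size of the final set (equivalently, the number of moves) when Sweller moves first and both players play optimally. *)

(* Defs.v *)
From mathcomp Require Import all_boot all_order all_algebra.

Set Implicit Arguments.
Unset Strict Implicit.
Unset Printing Implicit Defensive.

Record sgraph := SGraph {
  vertex :> finType;
  adj : rel vertex;
  adj_sym : symmetric adj;
  adj_irrefl : irreflexive adj
}.

Definition connected (G : sgraph) : Prop :=
  0 < #|G| /\ forall x y : G, connect (@adj G) x y.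

(* In a symmetric relation an edge traversed back and forth is a ucycle of
   size 2; genuine graph cycles have at least 3 vertices. *)
Definition acyclic (G : sgraph) : Prop :=
  forall c : seq G, ucycle (@adj G) c -> size c < 3.

Definition is_tree (G : sgraph) : Prop := connected G /\ acyclic G.

Definition legal (G : sgraph) (S : {set G}) : {set G} :=
  [set v | (v \notin S) && [forall u in S, ~~ adj u v]].

Inductive player := Sweller | Diminisher.

Definition opponent (p : player) : player :=
  if p is Sweller then Diminisher else Sweller.

(* Size of the final set under optimal play, when the vertices of S have been
   chosen and p is to move. The argument k bounds the number of remaining
   moves; any k >= #|G| - #|S| gives the same value. The default #|G| of
   the minimum is harmless, since no set of vertices is larger (see
   game_value_rec). *)
Fixpoint game_value_upto (G : sgraph) (k : nat) (p : player) (S : {set G}) :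
    nat :=
  if k is k'.+1 then
    if legal S == set0 then #|S|
    else if p is Sweller then
      \max_(v in legal S) game_value_upto k' (opponent p) (v |: S)
    else
      \big[minn/#|G|]_(v in legal S) game_value_upto k' (opponent p) (v |: S)
  else #|S|.

Definition game_value (G : sgraph) (p : player) (S : {set G}) : nat :=
  game_value_upto #|G| p S.

Definition I_s (G : sgraph) : nat := @game_value G Sweller set0.

Lemma card_legal (G : sgraph) (S : {set G}) (v : G) :
  v \in legal S -> #|v |: S| = #|S|.+1.
Proof. by rewrite inE => /andP[vS _]; rewrite cardsU1 vS. Qed.

Lemma game_value_upto_stable (G : sgraph) k l p (S : {set G}) :
  #|G| - #|S| <= k -> #|G| - #|S| <= l ->
  game_value_upto k p S = game_value_upto l p S.
Proof.
have full (S' : {set G}) : #|G| - #|S'| <= 0 -> legal S' = set0.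
  rewrite leqn0 subn_eq0 => GS; apply/setP=> v; rewrite !inE.
  suff -> : S' = setT by rewrite inE.
  by apply/eqP; rewrite eqEcard subsetT cardsT.
elim: k l p S => [|k IHk] [|l] p S //= hk hl.
- by rewrite (full _ hk) eqxx.
- by rewrite (full _ hl) eqxx.
have step v : v \in legal S ->
    game_value_upto k (opponent p) (v |: S)
    = game_value_upto l (opponent p) (v |: S).
  by move=> vS; apply: IHk; rewrite (card_legal vS) subnS -ltnS;
     case: (#|G| - #|S|) hk hl.
by case: p step => step; rewrite (eq_bigr _ step).
Qed.

Lemma game_value_end (G : sgraph) p (S : {set G}) :
  legal S = set0 -> game_value p S = #|S|.
Proof. by rewrite /game_value; case: #|G| => //= n ->; rewrite eqxx. Qed.

Lemma game_value_rec (G : sgraph) p (S : {set G}) :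
  legal S != set0 ->
  let next v := game_value (opponent p) (v |: S) in
  (exists2 v, v \in legal S & game_value p S = next v) /\
  (forall v, v \in legal S ->
     if p is Sweller then next v <= game_value p S
     else game_value p S <= next v).
Proof.
move=> nS next.
have upto_le k q (S' : {set G}) : game_value_upto k q S' <= #|G|.
  elim: k q S' => [|k IHk] q S' /=; first exact: max_card.
  case: ifP => [_|/negbT/set0Pn[v vS]]; first exact: max_card.
  case: q; first by apply/bigmax_leqP => u _; apply: IHk.
  by elim/big_ind: _ => // x y xG _; apply: leq_trans xG; apply: geq_minl.
have rec : game_value p S =
    if p is Sweller then \max_(v in legal S) next v
    else \big[minn/#|G|]_(v in legal S) next v.
  rewrite {1}/game_value (@game_value_upto_stable G _ #|G|.+1) ?leq_subr //.
    by rewrite /= (negPf nS).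
  by rewrite (leq_trans (leq_subr _ _)).
have minS v : v \in legal S -> \big[minn/#|G|]_(u in legal S) next u <= next v.
  move=> vS; have := mem_index_enum v; elim: (index_enum _) => // u s IHs.
  rewrite inE big_cons => /orP[/eqP <-|vs]; first by rewrite vS geq_minl.
  by case: ifP => _; rewrite ?geq_min IHs ?orbT.
have [v0 v0S] := set0Pn _ nS.
case: p @next rec minS => next -> minS; split.
- have cS : 0 < #|legal S| by rewrite card_gt0.
  by have [v vS ->] := eq_bigmax_cond next cS; exists v.
- by move=> v vS; apply: leq_bigmax_cond.
- case: (arg_minnP next v0S) => v vS vmin; exists v => //.
  apply/eqP; rewrite eqn_leq; apply/andP; split.
    exact: minS.
  elim/big_ind: _ => //; first exact: upto_le.
  by move=> x y vx vy; rewrite leq_min vx.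
- exact: minS.
Qed.

(* Main.v *)
Require Import Defs.
From mathcomp Require Import all_boot all_order all_algebra.
From mathcomp Require Import zify.

Set Implicit Arguments.
Unset Strict Implicit.
Unset Printing Implicit Defensive.

Import GRing.Theory Num.Theory.

(** The tree consists of two adjacent centres, each carrying [k] legs of length
    three, so [n = 6 k + 2].  Once the centre of one spider is chosen, each of
    its legs contributes at most 1 to the final set, and each leg of the other
    spider at most 2, or only 1 if its middle vertex is chosen.  Diminisher
    answers the first move by taking the centre of the spider that Sweller did
    not touch, and from then on takes middle vertices in the other spider.
    A move spoils at most one of these, so Diminisher gets about [k / 2] of
    them, and the final set has about [3 k - k / 2 = 5 n / 12] vertices. *)

(* Both neighbours of a highest vertex of a cycle would be its parent. *)
Lemma acyclic_parent (G : sgraph) (h : G -> nat) (p : G -> G) :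
  (forall x y, adj x y -> h y <= h x -> y = p x) -> acyclic G.
Proof.
move=> hp c /andP[cyc_c uniq_c]; rewrite ltnNge; apply/negP => size_c.
have [x0 x0c] : exists x, x \in c.
  by case: c size_c {cyc_c uniq_c} => // x c; exists x; rewrite mem_head.
case: (arg_maxnP h x0c) => x xc xmax.
have [i s def_s] := rot_to xc.
have mem_s y : y \in x :: s -> h y <= h x by rewrite -def_s mem_rot; apply: xmax.
move: cyc_c uniq_c size_c.
rewrite -(rot_cycle i) -(rot_uniq i) -(size_rot i) def_s.
case: s mem_s {def_s} => [|y s] // mem_s; case/lastP: s mem_s => // s z mem_s.
rewrite /= rcons_path last_rcons => /and3P[xy _ zx] uniq_s _.
have yz : y = z.
  rewrite (hp x y xy) ?mem_s ?inE ?eqxx ?orbT //.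
  by rewrite -(hp x z) ?mem_s ?inE ?mem_rcons ?inE ?eqxx ?orbT 1?adj_sym.
by move: uniq_s; rewrite -yz mem_rcons mem_head andbF.
Qed.

(** The inequality lets a root be its own parent without creating a loop. *)
Definition parent_adj (V : finType) (p : V -> V) : rel V :=
  fun x y => (x != y) && ((y == p x) || (x == p y)).

Lemma parent_adj_sym (V : finType) (p : V -> V) : symmetric (parent_adj p).
Proof. by move=> x y; rewrite /parent_adj eq_sym orbC. Qed.

Lemma parent_adj_irrefl (V : finType) (p : V -> V) :
  irreflexive (parent_adj p).
Proof. by move=> x; rewrite /parent_adj eqxx. Qed.

Definition parent_graph (V : finType) (p : V -> V) :=
  SGraph (parent_adj_sym p) (parent_adj_irrefl p).

(** Iterating [p] lowers [h] until [r] is reached, which connects every vertex to [r];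
    [acyclic_parent] rules out cycles. *)
Lemma parent_graph_tree (V : finType) (p : V -> V) (r : V) (h : V -> nat) :
  (forall x, x != r -> h (p x) < h x) -> p r = r -> is_tree (parent_graph p).
Proof.
move=> hp pr; split; last first.
  apply: (@acyclic_parent (parent_graph p) h p) => x y /= /andP[xy].
  case/orP=> [/eqP //|/eqP xpy] hyx.
  (* If [x] is the parent of [y], then [y = r] would force [x = y], and otherwise [x] lies strictly
     below [y], against [hyx]. *)
  have yr : y != r by apply: contraNneq xy => yr; rewrite xpy yr pr.
  by have := hp y yr; rewrite -xpy ltnNge hyx.
split; first by rewrite cardE; case: (enum _) (mem_enum V r).
have to_r x : connect (parent_adj p) x r.
  have [n] := ubnP (h x); elim: n x => // n IHn x; rewrite ltnS => hx.
  have [-> //|xr] := eqVneq x r.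
  apply: (connect_trans _ (IHn (p x) (leq_trans (hp x xr) hx))).
  apply: connect1; rewrite /parent_adj eqxx andbT.
  by apply/eqP => xp; have := hp x xr; rewrite -xp ltnn.
have csym := sym_connect_sym (parent_adj_sym p).
by move=> x y; apply: connect_trans (to_r x) _; rewrite csym to_r.
Qed.

Lemma game_value_Sweller (G : sgraph) (S : {set G}) : legal S != set0 ->
  exists2 v, v \in legal S &
    game_value Sweller S = game_value Diminisher (v |: S).
Proof. by case/(game_value_rec Sweller). Qed.

Lemma game_value_Diminisher (G : sgraph) (S : {set G}) v :
  v \in legal S -> game_value Diminisher S <= game_value Sweller (v |: S).
Proof.
move=> vS; have nS : legal S != set0 by apply/set0Pn; exists v.
by have [_ /(_ v vS)] := game_value_rec Diminisher nS.
Qed.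

Definition independent (G : sgraph) (S : {set G}) :=
  {in S &, forall u v, ~~ adj u v}.

Lemma independent_legal (G : sgraph) (S : {set G}) (v : G) :
  independent S -> v \in legal S -> independent (v |: S).
Proof.
move=> indS; rewrite inE => /andP[_ /forall_inP vS] x y.
rewrite !in_setU1 => /predU1P[->|xS] /predU1P[->|yS].
- by rewrite adj_irrefl.
- by rewrite adj_sym vS.
- exact: vS.
- exact: indS.
Qed.

Lemma legalU1 (G : sgraph) (S : {set G}) (v w : G) :
  w \in legal S -> w != v -> ~~ adj v w -> w \in legal (v |: S).
Proof.
rewrite !inE => /andP[wS /forall_inP Sw] wv vw.
rewrite negb_or wv wS; apply/forall_inP => u.
by rewrite in_setU1 => /predU1P[->|/Sw].
Qed.

(* [inl b] is the centre of spider [b]; [inr (b, l, i)] is the vertex at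
   distance [i + 1] from it on leg [l]. *)
Definition spider_vertex (k : nat) : finType := (bool + bool * 'I_k * 'I_3)%type.

(** The root is [inl false]; being also the parent of [inl true], it is joined to the other
    centre. *)
Definition spider_parent k (v : spider_vertex k) : spider_vertex k :=
  match v with
  | inl b => inl false
  | inr (b, l, i) => if i == ord0 then inl b else inr (b, l, inord i.-1)
  end.

Definition spider_depth k (v : spider_vertex k) : nat :=
  match v with
  | inl b => b
  | inr (b, l, i) => (b + i).+1
  end.

Definition double_spider k : sgraph := parent_graph (@spider_parent k).

Lemma double_spider_tree k : is_tree (double_spider k).
Proof.
apply: (@parent_graph_tree _ _ (inl false) (@spider_depth k)) => //.
case=> [[]|[[b l] i]] //= _; case: eqP => /= [-> |]; first by rewrite addn0.
by move/eqP; rewrite -val_eqE /= => i0; rewrite inordK; have := ltn_ord i; lia.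
Qed.

Lemma card_double_spider k : #|double_spider k| = 6 * k + 2.
Proof. by rewrite card_sum !card_prod card_bool !card_ord; lia. Qed.

Definition mid k (b : bool) (l : 'I_k) : double_spider k := inr (b, l, inord 1).

Definition taken k b (S : {set double_spider k}) := [set l | mid b l \in S].
Definition open k b (S : {set double_spider k}) := [set l | mid b l \in legal S].

Lemma mid_near k b l (v : double_spider k) :
  v = mid b l \/ adj v (mid b l) -> exists i, v = inr (b, l, i).
Proof.
case=> [->|]; first by eexists.
rewrite /= /parent_adj /spider_parent /mid /=.
case: v => [c|[[c m] i]] /andP[_ /orP[]].
- by [].
- by rewrite -val_eqE /= inordK.
- by case: ifP => // _ /eqP[-> -> _]; exists i.
- by rewrite -val_eqE /= inordK //= => /eqP[-> -> ->]; eexists.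
Qed.

(** By [mid_near], a move that closes a leg lies on that leg, and a vertex lies on at most one
    leg. *)
Lemma card_open k b (S : {set double_spider k}) v :
  #|open b S| <= #|open b (v |: S)|.+1.
Proof.
rewrite -(cardsID (open b (v |: S)) (open b S)) -addn1 leq_add //.
  by rewrite subset_leq_card // subsetIr.
apply/card_le1_eqP => l m.
have near x : x \in open b S :\: open b (v |: S) -> exists i, v = inr (b, x, i).
  rewrite in_setD ![x \in open _ _]inE => /andP[xv xS]; apply: mid_near.
  have [->|vx] := eqVneq v (mid b x); [by left | right].
  by apply: contraR xv => av; apply: legalU1; rewrite // eq_sym.
move=> lA mA; have [i vl] := near l lA.
by have [j] := near m mA; rewrite vl => -[].
Qed.

Lemma card_taken k b (S : {set double_spider k}) v :
  #|taken b S| <= #|taken b (v |: S)|.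
Proof.
by apply/subset_leq_card/subsetP => l; rewrite !inE => ->; rewrite orbT.
Qed.

Lemma card_taken_mid k b (S : {set double_spider k}) l :
  l \in open b S -> #|taken b (mid b l |: S)| = #|taken b S|.+1.
Proof.
rewrite !inE => /andP[lS _].
rewrite (_ : taken b _ = l |: taken b S) ?cardsU1 ?inE ?lS //.
by apply/setP => m; rewrite !inE; congr (_ || _); apply/eqP/eqP => [[->]|->].
Qed.

Lemma adj_leg k c (l : 'I_k) i :
  i < 2 -> @adj (double_spider k) (inr (c, l, inord i)) (inr (c, l, inord i.+1)).
Proof.
move=> i2; have i3 : i < 3 by apply: ltnW.
rewrite /= /parent_adj; apply/andP; split.
  by apply/eqP => -[] /(congr1 val); rewrite /= !inordK //; lia.
apply/orP; right; rewrite /= ifF; last by rewrite -val_eqE /= inordK.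
by rewrite inordK.
Qed.

Lemma adj_centre k c (l : 'I_k) :
  @adj (double_spider k) (inl c) (inr (c, l, inord 0)).
Proof.
rewrite /= /parent_adj; apply/andP; split => //; apply/orP; right.
by rewrite /= ifT // -val_eqE /= inordK.
Qed.

(** The chosen centre excludes the other centre and the first vertex of each of its own legs, whose
    last two vertices are adjacent. On a leg opposite, counting the middle vertex twice gives the
    sum over its two edges, hence at most 2. *)
Lemma card_independent k b (S : {set double_spider k}) :
  independent S -> inl b \in S -> #|S| + #|taken (~~ b) S| <= 3 * k + 1.
Proof.
move=> indS bS.
have edge (u v : double_spider k) : adj u v -> (u \in S) + (v \in S) <= 1.
  move=> uv; case uS: (u \in S); case vS: (v \in S) => //.
  by have := indS _ _ uS vS; rewrite uv.
pose leg c l i : nat := (inr (c, l, inord i) : double_spider k) \in S.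
have bc (c : bool) : (inl c : double_spider k) \in S <= (c == b).
  have [-> |cb] := eqVneq c b; first by case: (_ \in S).
  have := edge (inl b) (inl c); rewrite bS /= /parent_adj /=.
  by case: c b cb {bS} => -[] //= _ /(_ isT); case: (_ \in S).
have root_out l : leg b l 0 = 0.
  by have := edge _ _ (adj_centre b l); rewrite bS /leg; case: (_ \in S).
have leg01 c l : leg c l 0 + leg c l 1 <= 1 by apply/edge/adj_leg.
have leg12 c l : leg c l 1 + leg c l 2 <= 1 by apply/edge/adj_leg.
have cardS : #|S| = \sum_c ((inl c : double_spider k) \in S) +
    \sum_c \sum_l (leg c l 0 + leg c l 1 + leg c l 2).
  rewrite -sum1_card big_mkcond big_sumType /=; congr (_ + _).
  rewrite pair_bigA /=.
  transitivity (\sum_(cl : bool * 'I_k) \sum_(i : 'I_3)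
      ((inr (cl, i) : double_spider k) \in S : nat)).
    by rewrite pair_bigA; apply: eq_bigr => -[cl i] _ /=; case: ifP.
  apply: eq_bigr => -[c l] _ /=.
  transitivity (\sum_(i < 3) leg c l i); last by rewrite !big_ord_recr big_ord0.
  by apply: eq_bigr => i _; rewrite /leg inord_val.
have card_taken_leg : #|taken (~~ b) S| = \sum_l leg (~~ b) l 1.
  rewrite -sum1_card big_mkcond; apply: eq_bigr => l _.
  by rewrite inE /leg /mid; case: (_ \in S).
have sum_bool (F : bool -> nat) : \sum_c F c = F b + F (~~ b).
  by rewrite big_bool; case: (b); rewrite // addnC.
have sum_le (F : 'I_k -> nat) m : (forall l, F l <= m) -> \sum_l F l <= k * m.
  move=> Fm; rewrite (_ : k * m = \sum_(l < k) m) ?leq_sum //.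
  by rewrite sum_nat_const card_ord.
(* The summands bound, in order, centre [b], the other centre, the legs at [b], and the opposite
   legs with middles counted twice. *)
have -> : 3 * k + 1 = (b == b) + ((~~ b == b) + (k * 1 + k * 2)).
  by rewrite eqxx (_ : (~~ b == b) = false) /=; [lia | case: (b)].
rewrite cardS card_taken_leg !sum_bool -!addnA -big_split /=.
rewrite !leq_add ?bc ?sum_le // => l; first by rewrite root_out leg12.
by have := leg01 (~~ b) l; have := leg12 (~~ b) l; lia.
Qed.

Lemma legal_centre k b l i :
  inl b \in @legal (double_spider k) [set inr (~~ b, l, i)].
Proof.
rewrite !inE /=; apply/forall_inP => u; rewrite inE => /eqP ->.
rewrite /= /parent_adj /=; case: ifP => // _.
by apply/negP => /eqP[]; case: (b).
Qed.

(** Players compete for the open legs: Diminisher can count on half of them, rounded up when on move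
    and down otherwise. Adding [tempo] before halving encodes this rounding. *)
Definition tempo p := if p is Diminisher then 1 else 0.

(** Under Diminisher's strategy the two terms added to the value never decrease in total. A move of
    Sweller closes at most one leg but raises [tempo]; taking an open middle raises [taken] by one
    and lowers the half by at most one. *)
Lemma game_value_centre k b p (S : {set double_spider k}) :
  independent S -> inl b \in S ->
  game_value p S + #|taken (~~ b) S| + (tempo p + #|open (~~ b) S|)./2
    <= 3 * k + 1.
Proof.
have [tempoS tempoD] : tempo Sweller = 0 /\ tempo Diminisher = 1 by [].
have [n] := ubnP #|~: S|; elim: n p S => // n IHn p S.
rewrite ltnS => leSn indS bS.
have next v q : v \in legal S ->
    game_value q (v |: S) + #|taken (~~ b) (v |: S)| +
      (tempo q + #|open (~~ b) (v |: S)|)./2 <= 3 * k + 1.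
  move=> vS; apply: IHn; last by rewrite in_setU1 bS orbT.
    apply: leq_trans leSn; have := card_legal vS.
    by have := cardsC S; have := cardsC (v |: S); lia.
  exact: independent_legal.
(* At the end no leg is open, the half vanishes, and the static count applies. *)
have [legal0|legalS] := eqVneq (legal S) set0.
  rewrite game_value_end // (_ : open _ S = set0) ?cards0.
    by case: p; rewrite ?addn0; apply: card_independent.
  by apply/setP => l; rewrite !inE -[RHS](in_set0 (mid (~~ b) l)) -legal0 !inE.
case: p.
  have [v vS ->] := game_value_Sweller legalS; have := next v Diminisher vS.
  by have := card_open (~~ b) S v; have := card_taken (~~ b) S v; lia.
(* With no open leg the half is [1./2 = 0], so any legal move will do. *)
have [open0|/set0Pn[l lS]] := eqVneq (open (~~ b) S) set0.
  have [v vS] := set0Pn _ legalS; have := next v Sweller vS.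
  have := game_value_Diminisher vS; have := card_taken (~~ b) S v.
  by rewrite open0 cards0; lia.
have lL : mid (~~ b) l \in legal S by move: lS; rewrite inE.
have := next _ Sweller lL; have := game_value_Diminisher lL.
by have := card_open (~~ b) S (mid (~~ b) l); rewrite card_taken_mid //; lia.
Qed.

Lemma I_s_double_spider k : 2 * I_s (double_spider k) <= 5 * k + 5.
Proof.
have legal0 (v : double_spider k) : v \in legal set0.
  by rewrite !inE; apply/forall_inP => u; rewrite inE.
have indep0 : independent (set0 : {set double_spider k}).
  by move=> u v; rewrite inE.
have open0 b : #|open b (set0 : {set double_spider k})| = k.
  rewrite (_ : open b _ = setT) ?cardsT ?card_ord //.
  by apply/setP => l; rewrite in_setT inE legal0.
have nonempty : legal (set0 : {set double_spider k}) != set0.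
  by apply/set0Pn; exists (inl true).
have tempoD : tempo Diminisher = 1 by [].
rewrite /I_s; have [v _ ->] := game_value_Sweller nonempty.
have indv := independent_legal indep0 (legal0 v).
case: v indv => [b|[[b l] i]] indv.
  (* Sweller has chosen a centre already, so Diminisher starts on the opposite middles at once, with
     at least [k - 1] legs open. *)
  have := game_value_centre Diminisher indv (setU11 _ _).
  by have := card_open (~~ b) set0 (inl b : double_spider k); rewrite open0; lia.
set v : double_spider k := inr (b, l, i) in indv *.
have cL : inl (~~ b) \in legal (v |: set0).
  by rewrite setU0 /v -{2}(negbK b) legal_centre.
(* Charging one leg to each of the first two moves leaves at least [k - 2] open with Sweller to
   move; this case gives the constant 5. *)
have := game_value_Diminisher cL.
have := game_value_centre Sweller (independent_legal indv cL) (setU11 _ _).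
have := card_open b (v |: set0) (inl (~~ b) : double_spider k).
by have := card_open b set0 v; rewrite open0 negbK; lia.
Qed.

Theorem theorem1 (N : nat) :
  exists T : sgraph,
    [/\ is_tree T, N <= #|T|
      & ((I_s T)%:R <= (5 * #|T|%:R + 26) / 12 :> rat)%R].
Proof.
exists (double_spider N); split; first exact: double_spider_tree.
  by rewrite card_double_spider; lia.
(* With [n = 6 N + 2], [5 n + 26] is [6 (5 N + 6)], so twice the game value may be as large as
   [5 N + 6]. *)
rewrite card_double_spider ler_pdivlMr // -!natrM -natrD ler_nat.
by have := I_s_double_spider N; lia.
Qed.
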